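(* Let $r$ and $s$ be any integers and $n$ a non-negative integer. Then \[ \sum_{j = 0}^n \frac{( - 1)^{rj} F_{2rj + s}}{\binom nj} = \frac{(n + 1)F_{rn + s}}{L_r^{n + 1}}\sum_{j = 0}^n \frac{( - 1)^{rj} L_r^{j} L_{r(j + 1)}}{j + 1}, \qquad \sum_{j = 0}^n \frac{( - 1)^{rj} L_{2rj + s}}{\binom nj} = \frac{(n + 1)L_{rn + s}}{L_r^{n + 1}}\sum_{j = 0}^n \frac{( - 1)^{rj} L_r^{j} L_{r(j + 1)}}{j + 1}. \]
   Context: $F_j$ and $L_j$ denote the Fibonacci and Lucas numbers, defined for all integers $j$ by $F_0=0$, $F_1=1$, $L_0=2$, $L_1=1$, $F_j=F_{j-1}+F_{j-2}$, $L_j=L_{j-1}+L_{j-2}$, extended to negative indices by $F_{-j}=(-1)^{j-1}F_j$, $L_{-j}=(-1)^jL_j$; equivalently $F_j=(\alpha^j-\beta^j)/\sqrt5$, $L_j=\alpha^j+\beta^j$ with $\alpha=(1+\sqrt5)/2$, $\beta=(1-\sqrt5)/2$. *)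

(* Defs.v *)
From mathcomp Require Import all_boot all_order all_algebra.
Set Implicit Arguments.
Unset Strict Implicit.
Unset Printing Implicit Defensive.
Import Order.TTheory GRing.Theory Num.Theory.
Local Open Scope ring_scope.

Fixpoint fib_nat (n : nat) : nat :=
  match n with
  | 0 => 0
  | n'.+1 => match n' with
             | 0 => 1
             | n''.+1 => fib_nat n' + fib_nat n''
             end
  end%N.

Fixpoint lucas_nat (n : nat) : nat :=
  match n with
  | 0 => 2
  | n'.+1 => match n' with
             | 0 => 1
             | n''.+1 => lucas_nat n' + lucas_nat n''
             end
  end%N.

(* [Negz k] is the integer -(k+1); with j = k+1, the second clauses read
   F_{-j} = (-1)^(j-1) F_j and L_{-j} = (-1)^j L_j. *)
Definition fib (j : int) : int :=
  match j with
  | Posz k => (fib_nat k)%:Z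
  | Negz k => (-1) ^+ k * (fib_nat k.+1)%:Z
  end.

Definition lucas (j : int) : int :=
  match j with
  | Posz k => (lucas_nat k)%:Z
  | Negz k => (-1) ^+ k.+1 * (lucas_nat k.+1)%:Z
  end.

Lemma fib_rec (j : int) : fib j = fib (j - 1) + fib (j - 2).
Proof.
case: j => [[|[|k]]|k] //.
- have -> : k.+2%:Z - 1 = k.+1%:Z by rewrite -addn1 PoszD addrK.
  have -> : k.+2%:Z - 2 = k%:Z by rewrite -addn2 PoszD addrK.
  by rewrite /= -PoszD.
- have -> : Negz k - 1 = Negz k.+1 by rewrite !NegzE -opprD -PoszD addn1.
  have -> : Negz k - 2 = Negz k.+2 by rewrite !NegzE -opprD -PoszD addn2.
  rewrite /fib -[fib_nat k.+3]/(fib_nat k.+2 + fib_nat k.+1)%N PoszD.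
  by rewrite !exprS !mulN1r opprK mulrDr mulNr addrA addNr add0r.
Qed.

Lemma lucas_rec (j : int) : lucas j = lucas (j - 1) + lucas (j - 2).
Proof.
case: j => [[|[|k]]|k] //.
- have -> : k.+2%:Z - 1 = k.+1%:Z by rewrite -addn1 PoszD addrK.
  have -> : k.+2%:Z - 2 = k%:Z by rewrite -addn2 PoszD addrK.
  by rewrite /= -PoszD.
- have -> : Negz k - 1 = Negz k.+1 by rewrite !NegzE -opprD -PoszD addn1.
  have -> : Negz k - 2 = Negz k.+2 by rewrite !NegzE -opprD -PoszD addn2.
  rewrite /lucas -[lucas_nat k.+3]/(lucas_nat k.+2 + lucas_nat k.+1)%N PoszD.
  by rewrite !exprS !mulN1r !opprK mulrDr !mulNr addrA subrr add0r.
Qed.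

(* Main.v *)
Require Import Defs.
From mathcomp Require Import all_boot all_order all_algebra.
From mathcomp Require Import ring zify.
Set Implicit Arguments.
Unset Strict Implicit.
Unset Printing Implicit Defensive.
Import Order.TTheory GRing.Theory Num.Theory.
Local Open Scope ring_scope.

(** For a sequence G with G_j = G_(j-1) + G_(j-2) over all integers, put
    U_n(s) = sum_(j <= n) (-1)^(rj) G_(2rj+s) b(n,j), where
    b(n,j) = 1 / ((n+1) 'C(n,j)).  The identity
    L_k G_m = G_(m+k) + (-1)^k G_(m-k), used once with k = r inside the sum and
    once with k = r(n+2) for the two extreme terms, and the relation
    b(n,j) = b(n+1,j) + b(n+1,j+1) give
    L_r U_(n+1)(s) = U_n(s+r) + (-1)^(r(n+1)) L_(r(n+2)) G_(r(n+1)+s) / (n+2),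
    and the theorem follows by induction on n, with s generalized. *)

Definition fib_like (R : zmodType) (G : int -> R) :=
  forall j, G j = G (j - 1) + G (j - 2).

(** Induction in both directions on two consecutive values. It reduces an identity between two
    solutions of the recurrence to the indices 0 and 1. *)
Lemma fib_like_eq0 (R : zmodType) (G : int -> R) :
  fib_like G -> G 0 = 0 -> G 1 = 0 -> forall k, G k = 0.
Proof.
move=> recG G0 G1 k; suff [] : G k = 0 /\ G (k + 1) = 0 by [].
elim/int_ind: k => [|n [IH1 IH2]|n [IH1 IH2]].
- by rewrite add0r.
- rewrite -addn1 PoszD; split=> //.
  have -> := recG (n%:Z + 1 + 1).
  have -> : n%:Z + 1 + 1 - 1 = n%:Z + 1 by ring.
  have -> : n%:Z + 1 + 1 - 2 = n%:Z by ring.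
  by rewrite IH1 IH2 addr0.
- have e1 : - (n.+1)%:Z + 1 = - n%:Z by lia.
  rewrite e1; split=> //.
  have := recG (- n%:Z + 1).
  have -> : - n%:Z + 1 - 1 = - n%:Z by ring.
  have -> : - n%:Z + 1 - 2 = - n.+1%:Z by lia.
  by rewrite IH1 IH2 add0r => <-.
Qed.

(** With [m] fixed, both sides satisfy the Fibonacci recurrence in [k], so it suffices to compare
    them at [k = 0] and [k = 1]. *)
Lemma lucasM_fib_like (R : comUnitRingType) (G : int -> R) (k m : int) :
  fib_like G ->
  (lucas k)%:~R * G m = G (m + k) + (-1) ^ k * G (m - k).
Proof.
move=> recG; apply/eqP; rewrite -subr_eq0; apply/eqP; move: k.
apply: fib_like_eq0 => [k||].
- rewrite [in LHS]lucas_rec intrD [in LHS](recG (m + k)).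
  (* The recurrence is run backwards here; its minus sign is absorbed by the sign change from
     [(-1) ^ k] to [(-1) ^ (k - 1)]. *)
  have -> : G (m - k) = G (m - (k - 2)) - G (m - (k - 1)).
    have -> := recG (m - (k - 2)).
    have -> : m - (k - 2) - 1 = m - (k - 1) by ring.
    have -> : m - (k - 2) - 2 = m - k by ring.
    by rewrite addrAC subrr add0r.
  have uN1 : (-1 : R) \is a GRing.unit by rewrite unitrN1.
  have -> : (-1 : R) ^ (k - 1) = - (-1) ^ k by rewrite exprzDr // exprN1 invrN1 mulrN1.
  have -> : (-1 : R) ^ (k - 2) = (-1) ^ k.
    by rewrite exprzDr // -[(-1) ^ (-2)]/(((-1) ^+ 2)^-1) sqrrN expr1n invr1 mulr1.
  rewrite !(addrA m); ring.
- by rewrite subr0 expr0z -[lucas 0]/(2%:Z) /=; ring.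
- rewrite (recG (m + 1)) addrK expr1z -[lucas 1]/(1%:Z).
  have -> : m + 1 - 2 = m - 1 by ring.
  ring.
Qed.

Lemma lucas_nat_gt0 n : (0 < lucas_nat n)%N.
Proof.
suff /andP[] : (0 < lucas_nat n)%N && (0 < lucas_nat n.+1)%N by [].
elim: n => // n /andP[L0 L1]; rewrite L1 andTb.
by rewrite -[lucas_nat n.+2]/(lucas_nat n.+1 + lucas_nat n)%N addn_gt0 L0 orbT.
Qed.

(** Allows division by powers of L_r for every integer r. *)
Lemma lucas_neq0 k : lucas k != 0.
Proof.
have nz n : (lucas_nat n)%:Z != 0 by rewrite eqz_nat -lt0n lucas_nat_gt0.
by case: k => n; rewrite /lucas // mulf_neq0 ?signr_eq0 ?nz.
Qed.

(* [inv_bin n j] is the beta integral of t^j (1 - t)^(n - j) over [0, 1]. *)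
Definition inv_bin (n j : nat) : rat := (n.+1%:R * 'C(n, j)%:R)^-1.

Lemma inv_bin0 n : inv_bin n 0 = n.+1%:R^-1.
Proof. by rewrite /inv_bin bin0 mulr1. Qed.

Lemma inv_binn n : inv_bin n n = n.+1%:R^-1.
Proof. by rewrite /inv_bin binn mulr1. Qed.

(** In integral form this is multiplication of the integrand by (1 - t) + t = 1. The proof is
    algebraic: expressing both binomials of row n+1 through 'C(n, j) leaves (n + 1 - j) + (j + 1) =
    n + 2. *)
Lemma inv_bin_split n j : (j <= n)%N ->
  inv_bin n j = inv_bin n.+1 j + inv_bin n.+1 j.+1.
Proof.
move=> le_jn.
have e1 : (j.+1%:R * 'C(n.+1, j.+1)%:R : rat) = n.+1%:R * 'C(n, j)%:R.
  by rewrite -!natrM mul_bin_diag.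
have e2 : ((n.+1 - j)%:R * 'C(n.+1, j)%:R : rat) = n.+1%:R * 'C(n, j)%:R.
  by rewrite -!natrM mul_bin_down.
have c0 : 'C(n, j)%:R != 0 :> rat by rewrite pnatr_eq0 -lt0n bin_gt0.
have nj0 : (n.+1 - j)%:R != 0 :> rat by rewrite pnatr_eq0 subn_eq0 -ltnNge ltnS.
have j0 : j.+1%:R != 0 :> rat by rewrite pnatr_eq0.
have n0 : n.+1%:R != 0 :> rat by rewrite pnatr_eq0.
have c1 : 'C(n.+1, j.+1)%:R = n.+1%:R * 'C(n, j)%:R / j.+1%:R :> rat.
  by rewrite -e1 mulrAC mulfV // mul1r.
have c2 : 'C(n.+1, j)%:R = n.+1%:R * 'C(n, j)%:R / (n.+1 - j)%:R :> rat.
  by rewrite -e2 mulrAC mulfV // mul1r.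
rewrite /inv_bin c1 c2 !invfM !invrK -!mulrA -mulrDr mulrA.
have -> : n.+2%:R = (n.+1 - j)%:R + j.+1%:R :> rat.
  by rewrite -natrD; congr (_%:R); lia.
have s0 : (n.+1 - j)%:R + j.+1%:R != 0 :> rat.
  by rewrite -natrD pnatr_eq0; lia.
field.
by rewrite c0 !nat1r n0 s0.
Qed.

Section RecurrentSum.

Variables (G : int -> rat) (r : int).
Hypothesis recG : fib_like G.

Let e : rat := (-1) ^ r.
Let L : rat := (lucas r)%:Q.

Let signM (j : nat) : (-1 : rat) ^ (r * j%:Z) = e ^+ j.
Proof. by rewrite -exprz_exp. Qed.

Let sign_sqr : e * e = 1.
Proof. by rewrite -expfzMl mulrNN mulr1 exp1rz. Qed.

Let sign_exp_sqr j : e ^+ j * e ^+ j = 1.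
Proof. by rewrite -exprMn sign_sqr expr1n. Qed.

Let U (n : nat) (s : int) : rat :=
  \sum_(0 <= j < n.+1) e ^+ j * G (2 * r * j%:Z + s) * inv_bin n j.

Let lucas_beta_sumS n s :
  L * U n.+1 s = U n (s + r)
    + e ^+ n.+1 * (lucas (r * (n.+1%:Z + 1)))%:Q * G (r * n.+1%:Z + s)
      / n.+2%:R.
Proof.
pose A j := e ^+ j * G (2 * r * j%:Z + s + r).
pose B j := e ^+ j.+1 * G (2 * r * j%:Z + s - r).
(* Raising j by one moves the argument by 2r, from -r to +r, and the two extra signs cancel. *)
have BA j : B j.+1 = A j.
  rewrite /A /B !exprS mulrA sign_sqr mul1r; congr (_ * G _).
  by rewrite -[j.+1]addn1 PoszD; ring.
have -> : L * U n.+1 s = \sum_(0 <= j < n.+2) A j * inv_bin n.+1 j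
                       + \sum_(0 <= j < n.+2) B j * inv_bin n.+1 j.
  rewrite -big_split mulr_sumr; apply: eq_bigr => j _ /=.
  have := lucasM_fib_like r (2 * r * j%:Z + s) recG.
  rewrite -/L -/e => h; rewrite /A /B exprS.
  have -> : L * (e ^+ j * G (2 * r * j%:Z + s) * inv_bin n.+1 j)
     = e ^+ j * (L * G (2 * r * j%:Z + s)) * inv_bin n.+1 j by ring.
  rewrite h; ring.
(* Detaching the last A term and the first B term aligns the rest, where equal coefficients meet
   adjacent weights. Both detached terms have weight 1/(n+2). *)
rewrite big_nat_recr //= [X in _ + X]big_nat_recl //=.
have -> : U n (s + r) = \sum_(0 <= j < n.+1) A j * inv_bin n.+1 j
                      + \sum_(0 <= j < n.+1) B j.+1 * inv_bin n.+1 j.+1.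
  rewrite -big_split; apply: eq_big_nat => j /andP[_ lt_jn] /=.
  by rewrite BA -mulrDr -inv_bin_split // /A addrA.
suff ends : A n.+1 + B 0 = e ^+ n.+1 * (lucas (r * (n.+1%:Z + 1)))%:Q
                             * G (r * n.+1%:Z + s).
  rewrite inv_bin0 inv_binn -ends; ring.
(* The arguments 2r(n+1) + s + r and s - r lie at distance r(n+2) on either side of r(n+1) + s. *)
rewrite -mulrA lucasM_fib_like // mulrDr /A /B; congr (_ * G _ + _).
  by ring.
have -> : n.+1%:Z + 1 = n.+2%:Z by lia.
rewrite signM [e ^+ n.+2]exprSr !mulrA sign_exp_sqr mul1r expr1.
by congr (_ * G _); rewrite -[n.+2]addn1 PoszD; ring.
Qed.

Lemma fib_like_sum_inv_bin n s :
  \sum_(0 <= j < n.+1)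
      (-1 : rat) ^ (r * j%:Z) * G (2 * r * j%:Z + s) / 'C(n, j)%:R
   = n.+1%:R * G (r * n%:Z + s) / (lucas r)%:Q ^+ n.+1
     * \sum_(0 <= j < n.+1)
         (-1 : rat) ^ (r * j%:Z) * (lucas r)%:Q ^+ j
         * (lucas (r * (j%:Z + 1)))%:Q / j.+1%:R.
Proof.
have L0 : L != 0 by rewrite intr_eq0 lucas_neq0.
have n0 : n.+1%:R != 0 :> rat by rewrite pnatr_eq0.
have -> : \sum_(0 <= j < n.+1)
    (-1 : rat) ^ (r * j%:Z) * G (2 * r * j%:Z + s) / 'C(n, j)%:R
    = n.+1%:R * U n s.
  rewrite mulr_sumr; apply: eq_bigr => j _.
  rewrite signM /inv_bin invfM mulrCA; congr (_ * _).
  by rewrite mulrA mulfV // mul1r.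
rewrite -!mulrA; congr (_ * _); rewrite -/L.
(* Clearing the denominator gives L^(n+1) U_n(s) = G_(rn+s) times the right-hand sum, the form
   suited to induction. *)
apply: (mulfI (expf_neq0 n.+1 L0)).
rewrite mulrCA mulVKf ?expf_neq0 //.
elim: n s {n0} => [|n IH] s.
  rewrite /U !big_nat1 inv_bin0 !mulr0 !expr0 expr0z add0r.
  have -> : r * (0%:Z + 1) = r by ring.
  rewrite -/L; by field.
(* The hypothesis is used at s + r: since rn + (s + r) = r(n+1) + s, its G factor is the one in the
   new term. *)
rewrite exprSr -mulrA lucas_beta_sumS mulrDr IH [in RHS]big_nat_recr //=.
have -> : r * n%:Z + (s + r) = r * n.+1%:Z + s by rewrite -addn1 PoszD; ring.
rewrite signM; ring.
Qed.

End RecurrentSum.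

Theorem theorem3 (r s : int) (n : nat) :
  (\sum_(0 <= j < n.+1)
      (-1 : rat) ^ (r * j%:Z) * (fib (2 * r * j%:Z + s))%:Q / 'C(n, j)%:R
   = n.+1%:R * (fib (r * n%:Z + s))%:Q / (lucas r)%:Q ^+ n.+1
     * \sum_(0 <= j < n.+1)
         (-1 : rat) ^ (r * j%:Z) * (lucas r)%:Q ^+ j
         * (lucas (r * (j%:Z + 1)))%:Q / j.+1%:R)
  /\
  (\sum_(0 <= j < n.+1)
      (-1 : rat) ^ (r * j%:Z) * (lucas (2 * r * j%:Z + s))%:Q / 'C(n, j)%:R
   = n.+1%:R * (lucas (r * n%:Z + s))%:Q / (lucas r)%:Q ^+ n.+1
     * \sum_(0 <= j < n.+1)
         (-1 : rat) ^ (r * j%:Z) * (lucas r)%:Q ^+ j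
         * (lucas (r * (j%:Z + 1)))%:Q / j.+1%:R).
Proof.
split.
- apply: (@fib_like_sum_inv_bin (fun j => (fib j)%:Q)) => j.
  by rewrite [in LHS]fib_rec intrD.
- apply: (@fib_like_sum_inv_bin (fun j => (lucas j)%:Q)) => j.
  by rewrite [in LHS]lucas_rec intrD.
Qed.
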